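(* Suppose $T_b\sim\mathrm{Geometric}(p)$ for all $b\in\mathcal B$, with $p=o(1/T)$. Then the perishing process is $\delta$-offset-expiring for any $$\delta\ \ge\ 2\log T\cdot\frac{Tp}{(1-Tp)^2} .$$ Moreover, $\underline X\ge1-3Tp-\frac{\log(3\log(T)/\delta)}{T}$ for any ordering $\sigma$. As a result, $$\mathcal L^{\mathrm{perish}}\le 3Tp+\frac{\log(3\log(T)/\delta)}{T} .$$
   Context: There are $T$ rounds and a set $\mathcal B$ of $B=T$ units of a resource, and exactly one individual arrives in each round almost surely ($N_t=1$ for all $t\in\{1,\dots,T\}$, so $N=T$). Units have independent perishing times $T_b$; $\mathrm{Geometric}(p)$ is supported on $\{1,2,\dots\}$ with $\Pr(T_b\le k)=1-(1-p)^k$. An ordering (allocation schedule) is a bijection $\sigma:\mathcal B\to\{1,\dots,B\}$. $P_{<t}=\sum_{b\in\mathcal B}\mathbf 1\{T_b<t\}$. For $\delta\in(0,1)$, the perishing process is $\delta$-offset-expiring if $\Pr\left(\frac{P_{<t}}{B}\le\frac{N_{<t}}{N}\ \forall t\ge2\right)\ge1-\delta$ with $N_{<t}=\sum_{t'<t}N_{t'}$, i.e. here, if $\Pr(P_{<t}\le t-1\ \forall t\in\{2,\dots,T\})\ge1-\delta$. The quantities $\underline X$ and $\mathcal L^{\mathrm{perish}}$ are defined (with demand deterministic) as follows. For $X\ge0$: $\tau_b(1\mid X,\sigma)=\inf\{t\in\{1,2,\dots\}:tX\ge\sigma(b)\}$ ($\inf\emptyset=\infty$); $\mu(X)=\sum_{b\in\mathcal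 B}\Pr(T_b<\min\{T,\tau_b(1\mid X,\sigma)\})$; $$\overline\Delta(X)=\min\Big\{B,\ \mu(X)+\tfrac12\Big(\log(3\log(T)/\delta)+\sqrt{\log^2(3\log(T)/\delta)+8\mu(X)\log(3\log(T)/\delta)}\Big)\Big\};$$ $\underline X=\sup\{X\mid X\le(B-\overline\Delta(X))/N\}$ (assumed attained) and $\mathcal L^{\mathrm{perish}}=\frac BN-\underline X=1-\underline X$. *)

(* Defs.v *)
From HB Require Import structures.
From mathcomp Require Import all_boot all_order all_algebra.
From mathcomp Require Import all_classical all_reals all_analysis.

Set Implicit Arguments.
Unset Strict Implicit.
Unset Printing Implicit Defensive.

Import Order.TTheory GRing.Theory Num.Theory.
Import numFieldNormedType.Exports.

Local Open Scope classical_set_scope.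
Local Open Scope ring_scope.

Section RandomVariables.
Context {R : realType} {d : measure_display} {Omega : measurableType d}.
Variable P : probability Omega R.

Definition mutually_independent {d' : measure_display} {S : measurableType d'}
    {I : finType} (X : I -> {RV P >-> S}) : Prop :=
  forall (J : {set I}) (A : I -> set S), (forall i, measurable (A i)) ->
    P [set w | forall i, i \in J -> A i (X i w)]
    = (\prod_(i in J) P (X i @^-1` A i))%E.

(* The case k = 0 says that the support is contained in {1, 2, ...}. *)
Definition geometric_law (X : {RV P >-> nat}) (p : R) : Prop :=
  forall k : nat, P [set w | (X w <= k)%N] = (1 - (1 - p) ^+ k)%:E.

End RandomVariables.

(* Rounds are numbered 1, ..., T. *)
Definition demand (t : nat) : nat := 1.

Definition demand_before (t : nat) : nat := (\sum_(1 <= s < t) demand s)%N.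

Definition total_demand (T : nat) : nat := demand_before T.+1.

Section Perishing.
Context {R : realType} {d : measure_display} {Omega : measurableType d}.
Variables (P : probability Omega R) (Units : finType).
Variables (Tb : Units -> {RV P >-> nat}) (T : nat).

Definition perished_before (t : nat) (w : Omega) : nat :=
  (\sum_(b : Units) (Tb b w < t))%N.

Definition offset_expiring (delta : R) : Prop :=
  ((1 - delta)%:E <=
   P [set w | forall t : nat, (2 <= t <= T)%N ->
        ((perished_before t w)%:R / #|Units|%:R
         <= (demand_before t)%:R / (total_demand T)%:R :> R)%R])%E.

Definition is_ordering (sigma : Units -> nat) : Prop :=
  set_bij [set: Units] [set k : nat | (1 <= k <= #|Units|)%N] sigma.

(* The earliest round by which b is allocated when X units are handed out per
   round; it is +oo (the infimum of the empty set) when there is none. *)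
Definition tau (sigma : Units -> nat) (X : R) (b : Units) : \bar R :=
  ereal_inf [set t%:R%:E | t in
    [set t : nat | (1 <= t)%N /\ (sigma b)%:R <= t%:R * X]].

Definition mu (sigma : Units -> nat) (X : R) : R :=
  \sum_(b : Units)
    fine (P [set w | ((Tb b w)%:R%:E < mine T%:R%:E (tau sigma X b))%E]).

Definition log_term (delta : R) : R := ln (3 * ln T%:R / delta).

Definition Delta_bar (delta : R) (sigma : Units -> nat) (X : R) : R :=
  let L := log_term delta in
  let m := mu sigma X in
  Num.min #|Units|%:R (m + 2^-1 * (L + Num.sqrt (L ^+ 2 + 8 * m * L))).

(* For 0 < delta < 1, T >= 2 and as many units as rounds, Delta_bar takes values
   in [0, T], so the set below contains 0 and is bounded above by 1: sup is a
   genuine supremum. *)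
Definition X_low (delta : R) (sigma : Units -> nat) : R :=
  sup [set X : R | 0 <= X /\
    X <= (#|Units|%:R - Delta_bar delta sigma X) / (total_demand T)%:R].

Definition loss_perish (delta : R) (sigma : Units -> nat) : R :=
  #|Units|%:R / (total_demand T)%:R - X_low delta sigma.

End Perishing.

(* Main.v *)
Require Import Defs.
From HB Require Import structures.
From mathcomp Require Import all_boot all_order all_algebra.
From mathcomp Require Import all_classical all_reals all_analysis.
From mathcomp Require Import ring lra.
Import Order.TTheory GRing.Theory Num.Theory.
Import numFieldNormedType.Exports.
Local Open Scope classical_set_scope.
Local Open Scope ring_scope.

(** The probability that [t] or more units perish before round [t] is bounded by
    Chebyshev's inequality: the number of these units has mean at most
    [(t - 1) T p] and a variance at most its mean, which gives
    [Tp / (1 - Tp)^2 * (1 / t)].  Summing over [t] costs a factor [ln T].  For the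
    second claim, [mu X <= T * Pr (T_b <= T - 1) <= T^2 p] for every [X] and every
    ordering, and [sqrt (L^2 + 8 m L) <= L + 4 m], so that
    [Delta_bar X <= 3 T^2 p + L]: hence [1 - 3 T p - L / T] satisfies the
    inequality that defines [X_low]. *)

(** * Elementary real inequalities *)

Lemma one_minus_expr_le {R : realFieldType} (p : R) (k : nat) : 0 <= p <= 1 ->
  1 - (1 - p) ^+ k <= k%:R * p.
Proof.
move=> /andP[p0 p1]; elim: k => [|k IH]; first by rewrite expr0 subrr mul0r.
have x0 : 0 <= (1 - p) ^+ k by rewrite exprn_ge0// subr_ge0.
have x1 : (1 - p) ^+ k <= 1 by rewrite exprn_ile1// ?subr_ge0// gerBl.
by rewrite exprS -natr1; nra.
Qed.

(** The bound telescopes: [ln (1 + x) <= x] at x = -1/(n+2) gives 1/(n+2) <= ln (n+2) - ln (n+1). *)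
Lemma sum_harmonic_le_ln {R : realType} (n : nat) :
  \sum_(i < n) (i.+2%:R^-1 : R) <= ln n.+1%:R.
Proof.
elim: n => [|n IH]; first by rewrite big_ord0 ln1.
rewrite big_ord_recr/=.
have n1 : 0 < n.+1%:R :> R by rewrite ltr0n.
have n2 : 0 < n.+2%:R :> R by rewrite ltr0n.
have E : 1 + - n.+2%:R^-1 = n.+1%:R / n.+2%:R :> R.
  by rewrite -[n.+2%:R]natr1 in n2 *; field; rewrite gt_eqF.
have : ln (1 + - n.+2%:R^-1) <= - n.+2%:R^-1 :> R.
  by apply: le_ln1Dx; rewrite ltrN2 invf_lt1// ltr1n.
by rewrite E ln_div ?posrE// => h; move: IH; set x := _^-1 in h *; lra.
Qed.

(** The square of the right side exceeds the radicand by 16 m^2. *)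
Lemma sqrt_sqrD8_le {R : rcfType} (L m : R) : 0 <= L -> 0 <= m ->
  Num.sqrt (L ^+ 2 + 8 * m * L) <= L + 4 * m.
Proof.
move=> L0 m0.
have h : 0 <= L + 4 * m by nra.
rewrite -[leRHS](ger0_norm h) -sqrtr_sqr ler_wsqrtr//.
by nra.
Qed.

(** * Chebyshev's inequality for counts of pairwise independent events *)

Section Tail.
Context {R : realType} {d : measure_display} {Omega : measurableType d}.
Variable P : probability Omega R.

(** Integration preserves nonnegativity; this turns a pointwise inequality between indicators into
    one between probabilities. *)
Lemma sum_indic_ge0 (s : seq (R * set Omega)) :
  (forall x, x \in s -> measurable x.2) ->
  (forall w, 0 <= \sum_(x <- s) x.1 * \1_(x.2) w) ->
  0 <= \sum_(x <- s) x.1 * fine (P x.2).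
Proof.
move=> ms s0.
(* Integrability is required at every index, hence the value 0 off [s]. *)
pose f (x : R * set Omega) (w : Omega) : \bar R :=
  if x \in s then (x.1%:E * (\1_(x.2) w)%:E)%E else 0%E.
have If x : P.-integrable setT (f x).
  rewrite /f; case: (boolP (x \in s)) => [/ms mx|_]; last exact: integrable0.
  by apply: integrableZl => //; exact: integrable_indic.
have : (0 <= \int[P]_w (\sum_(x <- s) f x w))%E.
  apply: integral_ge0 => w _.
  rewrite (eq_big_seq (fun x => (x.1 * \1_(x.2) w)%:E)).
    by rewrite sumEFin lee_fin.
  by move=> x xs; rewrite /f xs EFinM.
rewrite integral_sum//.
rewrite (eq_big_seq (fun x : R * set Omega => (x.1 * fine (P x.2))%:E)).
  by rewrite sumEFin lee_fin.
move=> x xs; rewrite /f xs integralZl//; last exact/integrable_indic/ms.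
by rewrite integral_indic ?setIT ?EFinM ?fineK ?fin_num_measure//; exact: ms.
Qed.

(** With S the count and m its mean, (t - m)^2 1_D <= (S - m)^2 holds pointwise. Expanding S^2 into
    indicators of pairwise intersections and taking probabilities leaves the variance m - m q, which
    is at most m. *)
Lemma count_tail (I : finType) (A : I -> set Omega) (q t : R) :
  (forall i, measurable (A i)) ->
  (forall i, P (A i) = q%:E) ->
  (forall i j, i != j -> P (A i `&` A j) = (q ^+ 2)%:E) ->
  #|I|%:R * q < t ->
  d.-measurable [set w | t <= \sum_i \1_(A i) w] /\
  fine (P [set w | t <= \sum_i \1_(A i) w])
    <= #|I|%:R * q / (t - #|I|%:R * q) ^+ 2.
Proof.
move=> mA PA PAA; set m := _ * q => mt; set D := [set w | _].
have mD : measurable D.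
  rewrite -[D]setTI; apply: measurable_fun_le => //.
  by apply: measurable_sum => i; exact: measurable_realfun.measurable_indic.
split=> //.
(* The terms of (S - m)^2 - (t - m)^2 1_D, as weighted sets. *)
pose s : seq (R * set Omega) :=
  [:: (- (t - m) ^+ 2, D), (m ^+ 2, setT) &
   [seq (- 2 * m, A i) | i <- enum I] ++
   [seq (1, A i `&` A j) | i <- enum I, j <- enum I]].
(* [g] is left free: it is first the indicator at a point, then the probability. *)
have Es (g : set Omega -> R) : \sum_(x <- s) x.1 * g x.2 =
    - (t - m) ^+ 2 * g D + (m ^+ 2 * g setT + (- 2 * m * \sum_i g (A i) +
      \sum_i \sum_j g (A i `&` A j))).
  rewrite !big_cons big_cat big_map big_allpairs_dep/= !big_enum/= -mulr_sumr.
  congr (_ + (_ + (_ + _))); apply: eq_bigr => i _; rewrite big_enum/=.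
  by apply: eq_bigr => j _; rewrite mul1r.
have : 0 <= \sum_(x <- s) x.1 * fine (P x.2).
  apply: sum_indic_ge0 => [x|w].
    rewrite !inE mem_cat => /orP[/eqP->|/orP[/eqP->|/orP[]]].
    - exact: mD.
    - exact: measurableT.
    - by move=> /mapP[i _ ->]; exact: mA.
    - by move=> /allpairsP[[i j] [_ _ ->]]; exact: measurableI.
  rewrite (Es (fun B => \1_B w)).
  under [X in _ + (_ + (_ + X))]eq_bigr do
    under eq_bigr do rewrite indicI.
  under [X in _ + (_ + (_ + X))]eq_bigr do rewrite -mulr_sumr.
  rewrite -mulr_suml indicT.
  set S := \sum_i _.
  have -> : cst 1 w = 1 :> R by [].
  have -> : - (t - m) ^+ 2 * \1_D w + (m ^+ 2 * 1 + (- 2 * m * S + S * S)) =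
      (S - m) ^+ 2 - (t - m) ^+ 2 * \1_D w by ring.
  rewrite indicE subr_ge0; case: (boolP (w \in D)) => [|_]; last first.
    by rewrite mulr0 sqr_ge0.
  rewrite inE /D/= -/S mulr1 => tS.
  by rewrite lerXn2r ?nnegrE ?subr_ge0 ?lerD2r// ltW// (lt_le_trans mt).
have sumC (c : R) : \sum_(i : I) c = #|I|%:R * c.
  by rewrite sumr_const mulr_natl; congr (_ *+ _); exact: eq_card.
rewrite (Es (fun B => fine (P B))) probability_setT/=.
under [\sum_i fine (P (A i))]eq_bigr do rewrite PA/=.
rewrite sumC -/m.
(* In each row the diagonal term contributes q and each of the others q^2. *)
under [X in _ + (_ + (_ + X))]eq_bigr => i _.
  rewrite (bigD1 i)//= setIid PA/=.
  under eq_bigr => j ji do rewrite PAA 1?eq_sym//=.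
  rewrite sumr_const cardC1 -mulr_natl; over.
rewrite sumC => h.
rewrite ler_pdivlMr; last by rewrite exprn_gt0// subr_gt0.
(* The truncated predecessor of [#|I|] agrees with real subtraction only for nonempty [I]. *)
have [I0|I0] := posnP #|I|.
  by move: h; rewrite /m I0 /=; nra.
have EI : #|I|.-1%:R = #|I|%:R - 1 :> R by rewrite -subn1 natrB.
rewrite EI in h.
move: h.
have -> : #|I|%:R * (q + (#|I|%:R - 1) * q ^+ 2) = m + m * (m - q).
  by rewrite /m; ring.
have mq : 0 <= m * q by rewrite /m -mulrA mulr_ge0// -expr2 sqr_ge0.
nra.
Qed.

End Tail.

(** * Geometric perishing times and the offset-expiring property *)

Lemma demand_beforeE (t : nat) : demand_before t = t.-1.
Proof. by rewrite /demand_before sum_nat_const_nat muln1 subn1. Qed.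

Section GeometricPerishing.
Context {R : realType} {d : measure_display} {Omega : measurableType d}.
Variables (P : probability Omega R) (Units : finType).
Variables (Tb : Units -> {RV P >-> nat}) (T : nat) (p : R).
Hypotheses (cardU : #|Units| = T) (T2 : (1 < T)%N) (p01 : 0 <= p <= 1).
Hypothesis geom : forall b, geometric_law (Tb b) p.

Let A t b : set Omega := Tb b @^-1` [set k | (k < t)%N].

Lemma measurable_RV_nat (b : Units) (B : set nat) :
  d.-measurable (Tb b @^-1` B).
Proof. exact: measurable_funPTI. Qed.

Lemma prob_perished_before_le (b : Units) (t : nat) :
  fine (P (A t.+1 b)) <= t%:R * p.
Proof.
have -> : P (A t.+1 b) = (1 - (1 - p) ^+ t)%:E by exact: (geom b t).
exact: one_minus_expr_le.
Qed.

Lemma perished_beforeE (t : nat) (w : Omega) :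
  (perished_before Tb t w)%:R = \sum_b \1_(A t b) w :> R.
Proof.
rewrite /perished_before natr_sum; apply: eq_bigr => b _.
by rewrite indicE mem_setE.
Qed.

Lemma perished_before_tail (t : nat) : mutually_independent Tb ->
  T%:R * p < 1 ->
  d.-measurable [set w | (t.+2 <= perished_before Tb t.+2 w)%N] /\
  fine (P [set w | (t.+2 <= perished_before Tb t.+2 w)%N])
    <= T%:R * p / (1 - T%:R * p) ^+ 2 * t.+2%:R^-1.
Proof.
move=> indep Tp1.
have -> : [set w | (t.+2 <= perished_before Tb t.+2 w)%N] =
    [set w | t.+2%:R <= \sum_b (\1_(A t.+2 b) w : R)].
  by apply/seteqP; split=> w /=; rewrite -perished_beforeE ler_nat.
pose q : R := 1 - (1 - p) ^+ t.+1.
have q0 : 0 <= q.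
  by move: p01 => /andP[p0 p1]; rewrite subr_ge0 exprn_ile1 ?subr_ge0 ?gerBl.
have qp : q <= t.+1%:R * p by exact: one_minus_expr_le.
have mA b : measurable (A t.+2 b) by exact: measurable_RV_nat.
have PA b : P (A t.+2 b) = q%:E by exact: (geom b t.+1).
have PAA b c : b != c -> P (A t.+2 b `&` A t.+2 c) = (q ^+ 2)%:E.
  move=> bc.
  have := indep [set b; c]%SET (fun=> [set k | (k < t.+2)%N]) (fun=> I).
  rewrite big_setU1 ?inE// big_set1/= -/(A t.+2 b) -/(A t.+2 c) !PA -EFinM.
  move=> <-; congr (P _); apply/seteqP; split => w /=.
    by move=> [wb wc] i; rewrite !inE => /orP[]/eqP->.
  by move=> wi; split; apply: wi; rewrite !inE eqxx ?orbT.
have T0 : 0 < T%:R :> R by rewrite ltr0n (ltn_trans _ T2).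
have t2 : 0 < t.+2%:R :> R by rewrite ltr0n.
have p0 : 0 <= p by case/andP: p01.
(* The factor t+1 of the mean is relaxed to t+2, so that the gap to the threshold is at least
   (t+2)(1 - Tp) and one factor t+2 cancels in the quotient. *)
have Tq : T%:R * q <= t.+2%:R * (T%:R * p).
  rewrite mulrCA ler_wpM2l ?(ltW T0)// (le_trans qp)//.
  by rewrite ler_wpM2r// ler_nat.
have Tqt : t.+2%:R * (1 - T%:R * p) <= t.+2%:R - T%:R * q.
  by rewrite mulrBr mulr1 lerB.
have Tp0 : 0 < t.+2%:R * (1 - T%:R * p) by rewrite mulr_gt0// subr_gt0.
have Tqlt : #|Units|%:R * q < t.+2%:R.
  by rewrite cardU -subr_gt0 (lt_le_trans Tp0).
have [mD PD] := count_tail P _ (A t.+2) q t.+2%:R mA PA PAA Tqlt.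
split=> //; apply: (le_trans PD); rewrite cardU.
rewrite (@le_trans _ _ (t.+2%:R * (T%:R * p) / (t.+2%:R * (1 - T%:R * p)) ^+ 2))//.
  apply: ler_pM => //; first by rewrite mulr_ge0// ltW.
    by rewrite invr_ge0 sqr_ge0.
  rewrite lef_pV2 ?posrE ?exprn_gt0 ?(lt_le_trans Tp0)//.
  by rewrite lerXn2r ?nnegrE ?(ltW Tp0)// ltW// (lt_le_trans Tp0).
rewrite le_eqVlt; apply/orP; left; apply/eqP; field.
by rewrite !gt_eqF//= subr_gt0.
Qed.

Lemma geometric_offset_expiring (delta : R) : mutually_independent Tb ->
  T%:R * p < 1 ->
  2 * ln T%:R * (T%:R * p / (1 - T%:R * p) ^+ 2) <= delta ->
  offset_expiring Tb T delta.
Proof.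
move=> indep Tp1 hdelta; rewrite /offset_expiring.
pose D i := [set w | (i.+2 <= perished_before Tb i.+2 w)%N].
have mD i : measurable (D i) by have [] := perished_before_tail i indep Tp1.
have PD i := (perished_before_tail i indep Tp1).2.
have T0 : 0 < T%:R :> R by rewrite ltr0n (ltn_trans _ T2).
(* Counts are integers, so the condition fails at round t exactly when at least t units have
   perished; [D i] is failure at round i+2. A union bound follows. *)
rewrite [X in P X](_ : _ = ~` \big[setU/set0]_(i < T.-1) D i); last first.
  have E t w : (2 <= t <= T)%N ->
      ((perished_before Tb t w)%:R / #|Units|%:R <=
       (demand_before t)%:R / (total_demand T)%:R :> R)
      = ~~ (t <= perished_before Tb t w)%N.
    move=> /andP[t2 tT].
    rewrite /total_demand !demand_beforeE cardU ler_pM2r ?invr_gt0// ler_nat.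
    by case: t t2 tT => // t _ _; rewrite -ltnNge.
  rewrite -bigcup_mkord; apply/seteqP; split=> w /=.
    move=> h [i /= iT]; rewrite /D/= => wi.
    have it : (2 <= i.+2 <= T)%N by rewrite /= -(ltn_predK T2).
    by have := h _ it; rewrite E// wi.
  move=> h t tT; rewrite E//; apply/negP => wt; apply: h.
  move: t tT wt => [|[|t]]// /andP[_ tT] wt; exists t => //=.
  by rewrite -ltnS (ltn_predK T2).
rewrite probability_setC; last by apply: bigsetU_measurable.
have PU : (P (\big[setU/set0]_(i < T.-1) D i) <= delta%:E)%E.
  apply: (le_trans (Boole_inequality _ _)) => //.
  rewrite (eq_bigr (fun i : 'I_T.-1 => (fine (P (D i)))%:E)); last first.
    by move=> i _; rewrite fineK// fin_num_measure.
  rewrite sumEFin lee_fin; apply: le_trans hdelta.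
  set c := T%:R * p / _ in PD *.
  have c0 : 0 <= c.
    case/andP: p01 => p0 _.
    by rewrite divr_ge0 ?sqr_ge0// mulr_ge0// ltW.
  apply: (@le_trans _ _ (\sum_(i < T.-1) c * i.+2%:R^-1)).
    by apply: ler_sum => i _; exact: PD.
  (* The reciprocals of 2, ..., T sum to at most ln T. *)
  have := sum_harmonic_le_ln (R := R) T.-1; rewrite (ltn_predK T2) -mulr_sumr.
  have : 0 <= ln (T%:R : R) by rewrite ln_ge0// ler1n ltnW.
  by nra.
by rewrite EFinB leeB.
Qed.

(** * Bounds on [mu], [Delta_bar] and [X_low], uniform in the ordering *)

Lemma mu_bounds (sigma : Units -> nat) (X : R) :
  0 <= mu Tb T sigma X <= T%:R * (T%:R * p).
Proof.
have p0 : 0 <= p by case/andP: p01.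
apply/andP; split.
  by apply: sumr_ge0 => b _; rewrite fine_ge0.
have -> : T%:R * (T%:R * p) = \sum_(b : Units) T%:R * p.
  by rewrite sumr_const mulr_natl -cardU; congr (_ *+ _); exact: eq_card.
apply: ler_sum => b _.
have mS (B : set nat) := measurable_RV_nat b B.
(* Keeping only T in the minimum removes all dependence on [sigma] and [X]. *)
apply: (@le_trans _ _ (fine (P (A T b)))).
  apply: fine_le; rewrite ?fin_num_measure//.
  - exact: (mS [set k | (k%:R%:E < mine T%:R%:E (tau sigma X b))%E]).
  - exact: mS.
  - apply: le_measure; rewrite ?inE//.
    + exact: (mS [set k | (k%:R%:E < mine T%:R%:E (tau sigma X b))%E]).
    + exact: mS.
    + by move=> w /=; rewrite lt_min lte_fin ltr_nat => /andP[].
rewrite -[in A T](ltn_predK T2) (le_trans (prob_perished_before_le _ _))//.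
by rewrite ler_wpM2r// ler_nat leq_pred.
Qed.

Lemma Delta_bar_bounds (delta : R) (sigma : Units -> nat) (X : R) :
  0 <= log_term T delta ->
  0 <= Delta_bar Tb T delta sigma X
    <= 3 * (T%:R * (T%:R * p)) + log_term T delta.
Proof.
move=> L0; rewrite /Delta_bar; set L := log_term T delta in L0 *.
have /andP[] := mu_bounds sigma X; set m := mu _ _ _ _ => m0 mle.
have := sqrt_sqrD8_le L m L0 m0; have := sqrtr_ge0 (L ^+ 2 + 8 * m * L).
set r := Num.sqrt _ => r0 rle.
apply/andP; split; first by rewrite le_min ler0n/=; nra.
(* The constant 3 arises here: m + (L + (L + 4m))/2 = 3m + L. *)
by rewrite ge_min; apply/orP; right; nra.
Qed.

Lemma X_low_ge (delta : R) (sigma : Units -> nat) :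
  0 <= log_term T delta ->
  1 - 3 * T%:R * p - log_term T delta / T%:R <= X_low Tb T delta sigma.
Proof.
move=> L0; rewrite /X_low /total_demand demand_beforeE/= cardU.
set S := [set X : R | _].
have T0 : 0 < T%:R :> R by rewrite ltr0n (ltn_trans _ T2).
have ubS : has_ubound S.
  exists 1 => X [_]; move/le_trans; apply.
  have /andP[D0 _] := Delta_bar_bounds delta sigma X L0.
  by rewrite ler_pdivrMr// mul1r gerBl.
(* A nonpositive candidate is outside the set if negative; then 0 serves, as [Delta_bar] is capped
   at the number of units. A positive candidate is itself a member. *)
have [X0|X0] := leP (1 - 3 * T%:R * p - log_term T delta / T%:R) 0.
  apply: (le_trans X0); apply: ub_le_sup => //; split=> //.
  by rewrite divr_ge0 ?(ltW T0)// subr_ge0 /Delta_bar cardU ge_min lexx.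
apply: ub_le_sup => //; split; first exact: ltW.
set X := (X in Delta_bar _ _ _ _ X).
have /andP[_ DX] := Delta_bar_bounds delta sigma X L0.
rewrite ler_pdivlMr// /X !mulrBl mul1r divfK ?gt_eqF//.
by move: DX; rewrite -/X; nra.
Qed.

End GeometricPerishing.

(** * From p = o(1/T) to the bounds for all large T *)

Theorem proposition3 (R : realType) (p : nat -> R)
    (hp : forall T : nat, 0 < p T <= 1)
    (hpo : p =o_\oo (fun T : nat => (T%:R : R)^-1)) :
  exists T0 : nat, forall T : nat, (T0 <= T)%N ->
    forall (d : measure_display) (Omega : measurableType d)
           (P : probability Omega R) (Units : finType)
           (Tb : Units -> {RV P >-> nat}),
      #|Units| = T ->
      mutually_independent Tb ->
      (forall b : Units, geometric_law (Tb b) (p T)) ->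
      forall delta : R, 0 < delta < 1 ->
        (2 * ln T%:R * (T%:R * p T / (1 - T%:R * p T) ^+ 2) <= delta ->
           offset_expiring Tb T delta)
        /\ (forall sigma : Units -> nat, is_ordering sigma ->
              1 - 3 * T%:R * p T - ln (3 * ln T%:R / delta) / T%:R
                <= X_low Tb T delta sigma
              /\ loss_perish Tb T delta sigma
                <= 3 * T%:R * p T + ln (3 * ln T%:R / delta) / T%:R).
Proof.
have half0 : 0 < 2^-1 :> R by rewrite invr_gt0.
(* With the constant 1/2, eventually p <= 1/(2T), hence Tp < 1. *)
have [N _ HN] := (eqoP _ _ _).1 hpo _ half0.
exists (maxn N 2) => T; rewrite geq_max => /andP[NT T2].
move=> d Omega P Units Tb cardU indep geom delta /andP[d0 d1].
have /andP[p0 p1] := hp T.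
have p01 : 0 <= p T <= 1 by rewrite ltW.
have T0 : 0 < T%:R :> R by rewrite ltr0n (ltn_trans _ T2).
have Tp1 : T%:R * p T < 1.
  have := HN T NT; rewrite /= (gtr0_norm p0) gtr0_norm ?invr_gt0// => pT.
  rewrite mulrC -ltr_pdivlMr// mul1r (le_lt_trans pT)//.
  by rewrite gtr_pMl ?invr_gt0// invf_lt1// ltr1n.
split; first exact: (geometric_offset_expiring P Units Tb T (p T)).
move=> sigma _.
(* Since T >= 2, ln T >= ln 2 >= 1/2 (a one-term harmonic sum), so 3 ln T >= 3/2 > delta. *)
have L0 : 0 <= log_term T delta.
  have lnT : 2^-1 <= ln T%:R :> R.
    apply: (@le_trans _ _ (ln 2)); last by rewrite ler_ln ?posrE// ler_nat.
    have := sum_harmonic_le_ln (R := R) 1.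
    by rewrite big_ord_recr big_ord0/= add0r.
  rewrite ln_ge0// ler_pdivlMr// mul1r; lra.
have XL := X_low_ge P Units Tb T (p T) cardU T2 p01 geom delta sigma L0.
split; first exact: XL.
rewrite /loss_perish /total_demand demand_beforeE/= cardU divff ?gt_eqF//.
by move: XL; rewrite /log_term; lra.
Qed.
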